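(* Let $M$ be a complete semi-uniformly visible CAT(0) space. Then every parabolic isometry $\gamma$ of $M$ has zero translation length, i.e. $|\gamma|=0$.
   Context: $M$ is not assumed to be proper (locally compact). For a complete CAT(0) space $M$, $M(\infty)$ denotes the visual boundary, i.e. the set of equivalence classes of asymptotic unit-speed geodesic rays; $c(+\infty)$ denotes the class of a ray $c$, and for a geodesic line $c:\mathbb{R}\to M$, $c(-\infty)$ is the class of $t\mapsto c(-t)$, $t\ge 0$. $M$ is visible if for any $x\neq y$ in $M(\infty)$ there is a geodesic line $c:\mathbb{R}\to M$ with $c(-\infty)=x$ and $c(+\infty)=y$ (in particular $M$ is visible if $M(\infty)=\emptyset$). $M$ has an infinite-flat-strip if there is a totally geodesic convex subset of $M$ that is isometric to a metric product $U\times\mathbb{R}$ with $U$ unbounded. $M$ is semi-uniformly visible if it is visible and has no infinite-flat-strip. An isometry is a distance-preserving bijection $\gamma:M\to M$; its translation length is $|\gamma|:=\inf_{p\in M} dist(\gamma\cdot p,p)$. It is elliptic if it has a fixed point in $M$; hyperbolic if there is a geodesic line $c:\mathbb{R}\to M$ such that $\gamma$ acts on $c(\mathbb{R})$ by a non-trivial translation; parabolic if it is neither elliptic nor hyperbolic. *)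

(* Defs.v *)
From HB Require Import structures.
From mathcomp Require Import all_boot all_order all_algebra.
From mathcomp Require Import all_classical all_reals all_analysis.

Set Implicit Arguments.
Unset Strict Implicit.
Unset Printing Implicit Defensive.

Import Order.TTheory GRing.Theory Num.Theory.
Import numFieldNormedType.Exports.

Local Open Scope classical_set_scope.
Local Open Scope ring_scope.

(* The library's complete types are pointed, so these spaces are nonempty. *)
#[short(type="completeMetricType")]
HB.structure Definition CompleteMetric (K : numDomainType) :=
  { M of Metric K M & Complete M }.

Section CAT0.
Context {R : realType}.

(* The norm the library puts on 'rV[R]_2 is the sup norm, so the Euclidean
   distance is spelled out. *)
Definition euclid_dist (a b : 'rV[R]_2) : R :=
  Num.sqrt (\sum_(k < 2) (a 0 k - b 0 k) ^+ 2).

(* q is the point of the Euclidean segment [a, b] at distance s from a. *)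
Definition point_at (a b : 'rV[R]_2) (s : R) (q : 'rV[R]_2) : Prop :=
  (exists2 l : R, 0 <= l <= 1 & q = (1 - l) *: a + l *: b) /\
  euclid_dist a q = s.

Variable M : metricType R.
Implicit Types (C : set M) (g : M -> M).

(* Geodesics are functions on all of R; those defined on an interval are
   constrained, and used, only on that interval. *)
Definition geodesic_segment (x y : M) (c : R -> M) : Prop :=
  [/\ c 0 = x, c (mdist x y) = y &
      forall s t, 0 <= s <= mdist x y -> 0 <= t <= mdist x y ->
        mdist (c s) (c t) = `|s - t|].

Definition geodesic_ray (c : R -> M) : Prop :=
  forall s t, 0 <= s -> 0 <= t -> mdist (c s) (c t) = `|s - t|.

Definition geodesic_line (c : R -> M) : Prop :=
  forall s t, mdist (c s) (c t) = `|s - t|.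

Definition geodesic_space : Prop :=
  forall x y, exists c, geodesic_segment x y c.

(* The vertices of a triangle are x 0, x 1, x 2; its side c i joins x i to
   x (i + 1), indices mod 3. *)
Definition geodesic_triangle (x : 'I_3 -> M) (c : 'I_3 -> R -> M) : Prop :=
  forall i, geodesic_segment (x i) (x (ordS i)) (c i).

Definition comparison_triangle (x : 'I_3 -> M) (x' : 'I_3 -> 'rV[R]_2) : Prop :=
  forall i, euclid_dist (x' i) (x' (ordS i)) = mdist (x i) (x (ordS i)).

Definition CAT0 : Prop :=
  geodesic_space /\
  forall (x : 'I_3 -> M) (c : 'I_3 -> R -> M) (x' : 'I_3 -> 'rV[R]_2),
  geodesic_triangle x c -> comparison_triangle x x' ->
  forall (i j : 'I_3) (s t : R) (p' q' : 'rV[R]_2),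
    0 <= s <= mdist (x i) (x (ordS i)) ->
    0 <= t <= mdist (x j) (x (ordS j)) ->
    point_at (x' i) (x' (ordS i)) s p' ->
    point_at (x' j) (x' (ordS j)) t q' ->
    mdist (c i s) (c j t) <= euclid_dist p' q'.

Definition asymptotic (c c' : R -> M) : Prop :=
  exists K : R, forall t, 0 <= t -> mdist (c t) (c' t) <= K.

(* c(+oo), as the equivalence class of the ray c *)
Definition endpoint (c : R -> M) : set (R -> M) :=
  [set c' | geodesic_ray c' /\ asymptotic c c'].

(* M(oo) *)
Definition visual_boundary : set (set (R -> M)) :=
  [set endpoint c | c in geodesic_ray].

Definition visible : Prop :=
  forall u v, visual_boundary u -> visual_boundary v -> u <> v ->
  exists c, [/\ geodesic_line c,
                endpoint (fun t => c (- t)) = u & endpoint c = v].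

Definition totally_geodesic_convex C : Prop :=
  forall x y c, C x -> C y -> geodesic_segment x y c ->
  forall t, 0 <= t <= mdist x y -> C (c t).

Definition unbounded (U : metricType R) : Prop :=
  forall K : R, exists u v : U, K < mdist u v.

(* The metric product is the l^2 product. *)
Definition product_dist (U : metricType R) (p q : U * R) : R :=
  Num.sqrt (mdist p.1 q.1 ^+ 2 + (p.2 - q.2) ^+ 2).

Definition isometric_to_product C (U : metricType R) : Prop :=
  exists f : U * R -> M,
    range f = C /\ forall p q, mdist (f p) (f q) = product_dist p q.

Definition has_infinite_flat_strip : Prop :=
  exists C, totally_geodesic_convex C /\
    exists U : metricType R, unbounded U /\ isometric_to_product C U.

Definition semi_uniformly_visible : Prop :=
  visible /\ ~ has_infinite_flat_strip.

Definition is_isometry g : Prop :=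
  bijective g /\ forall x y, mdist (g x) (g y) = mdist x y.

Definition translation_length g : R := inf (range (fun p : M => mdist (g p) p)).

Definition elliptic g : Prop := exists p, g p = p.

Definition hyperbolic g : Prop :=
  exists c, geodesic_line c /\
    exists a : R, a <> 0 /\ forall t, g (c t) = c (t + a).

Definition parabolic g : Prop := ~ elliptic g /\ ~ hyperbolic g.

End CAT0.

(* Main.v *)
(* Suppose the translation length is positive. Karlsson-Margulis: the segments
   from p to gamma^N p, for N along record times of d(p, gamma^n p) - (L - e) n
   with L the linear rate of escape, converge to a ray which gamma^n p tracks up
   to o(n) and whose endpoint gamma fixes. The rays obtained for gamma and its
   inverse have different endpoints since d(gamma^n p, gamma^(-n) p) >= 2 n L.
   By visibility a line joins them, and gamma permutes the lines parallel to it.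
   These lines fill a convex product Y x R; without infinite flat strips Y is
   bounded, and the circumcenter of Y gives a line invariant under gamma, on
   which gamma acts by a translation. *)

Require Import Defs.
From HB Require Import structures.
From mathcomp Require Import all_boot all_order all_algebra.
From mathcomp Require Import all_classical all_reals all_analysis.
From mathcomp Require Import ring lra.

Set Implicit Arguments.
Unset Strict Implicit.
Unset Printing Implicit Defensive.

Import Order.TTheory GRing.Theory Num.Theory.
Import numFieldNormedType.Exports.

Local Open Scope classical_set_scope.
Local Open Scope ring_scope.

(** * Comparison triangles in the plane *)

Section comparison.
Context {R : realType}.

Definition plane_point (u v : R) : 'rV[R]_2 :=
  \row_(k < 2) (if k == 0 then u else v).

Lemma euclid_dist_plane (u v u' v' : R) :
  euclid_dist (plane_point u v) (plane_point u' v') =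
  Num.sqrt ((u - u') ^+ 2 + (v - v') ^+ 2).
Proof. by rewrite /euclid_dist big_ord_recl big_ord1 !mxE. Qed.

Lemma sqrt_sq_eq (a x : R) : 0 <= a -> x = a ^+ 2 -> Num.sqrt x = a.
Proof. by move=> a0 ->; rewrite sqrtr_sqr ger0_norm. Qed.

Variable M : metricType R.
Implicit Types x y z : M.

Local Notation d := (@mdist R M).

Lemma dist_ge0 x y : 0 <= d x y.
Proof. exact: mdist_ge0. Qed.

Lemma dist_eq0 x y : d x y = 0 -> x = y.
Proof. exact: mdist_positivity. Qed.

(** The comparison triangle is placed with its side from x to y on the first axis. The right side is
    then the squared Euclidean distance from the third vertex to the point at fraction [l] of that
    side. *)
Lemma CAT0_segment x y z (c : R -> M) (l : R) : CAT0 M ->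
  geodesic_segment x y c -> 0 <= l <= 1 ->
  d z (c (l * d x y)) ^+ 2 <=
  (1 - l) * d z x ^+ 2 + l * d z y ^+ 2 - l * (1 - l) * d x y ^+ 2.
Proof.
move=> [geo cat] cxy l01; have /andP[l0 l1] := l01.
have [xy0|xyN0] := eqVneq (d x y) 0.
  have [c0 _ _] := cxy; rewrite xy0 mulr0 c0 -(dist_eq0 xy0); lra.
have xyp : 0 < d x y by rewrite lt_neqAle eq_sym xyN0 dist_ge0.
have [c1 c1P] := geo y z; have [c2 c2P] := geo z x.
have t1 := metric_triangle x y z; have t2 := metric_triangle y z x.
have t3 := metric_triangle z x y.
rewrite (metric_sym y x) in t2; rewrite (metric_sym z y) in t3.
rewrite (metric_sym x z) in t1.
have zx0 := dist_ge0 z x; have yz0 := dist_ge0 y z.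
rewrite (metric_sym z y).
(* First coordinate of the third vertex, by the law of cosines. *)
pose u : R := (d x y ^+ 2 + d z x ^+ 2 - d y z ^+ 2) / (2 * d x y).
have uE : 2 * d x y * u = d x y ^+ 2 + d z x ^+ 2 - d y z ^+ 2.
  by rewrite /u; field; rewrite ?mulf_neq0 ?xyN0.
have uv : u ^+ 2 <= d z x ^+ 2.
  rewrite -subr_ge0 -(pmulr_rge0 _ (_ : 0 < 4 * d x y ^+ 2)); last first.
    by rewrite mulr_gt0 ?exprn_gt0.
  (* Heron's factorization; each factor is nonnegative by the triangle inequalities. *)
  have -> : 4 * d x y ^+ 2 * (d z x ^+ 2 - u ^+ 2) =
    ((d x y + d z x) ^+ 2 - d y z ^+ 2) * (d y z ^+ 2 - (d x y - d z x) ^+ 2).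
    transitivity ((2 * d x y * d z x) ^+ 2 - (2 * d x y * u) ^+ 2); first by ring.
    by rewrite uE; ring.
  apply: mulr_ge0; rewrite subr_sqr mulr_ge0 //; lra.
pose v : R := Num.sqrt (d z x ^+ 2 - u ^+ 2).
have vE : v ^+ 2 = d z x ^+ 2 - u ^+ 2 by rewrite sqr_sqrtr // subr_ge0.
pose X (i : 'I_3) := nth x [:: x; y; z] i.
pose C (i : 'I_3) := nth c [:: c; c1; c2] i.
pose X' (i : 'I_3) :=
  nth 0 [:: plane_point 0 0; plane_point (d x y) 0; plane_point u v] i.
have XC : geodesic_triangle X C by case=> [[|[|[|//]]] hi].
have E12 : euclid_dist (plane_point (d x y) 0) (plane_point u v) = d y z.
  rewrite euclid_dist_plane; apply: sqrt_sq_eq => //.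
  transitivity (d x y ^+ 2 - 2 * d x y * u + u ^+ 2 + v ^+ 2); first by ring.
  by rewrite uE vE; ring.
have XX' : comparison_triangle X X'.
  case=> [[|[|[|//]]] hi]; rewrite /X/X'/= ?E12 // euclid_dist_plane;
    (apply: sqrt_sq_eq; first exact: dist_ge0); first by ring.
  transitivity (u ^+ 2 + v ^+ 2); first by ring.
  by rewrite vE; ring.
(* The vertex z is taken as the far end of side 1, hence the parameter [d y z]. *)
have := cat X C X' XC XX' ord0 (inord 1) (l * d x y) (d y z)
  (plane_point (l * d x y) 0) (plane_point u v).
rewrite /X/X'/C /= !inordK //=.
have [_ -> _] := c1P.
move=> H.
have {}H : d z (c (l * d x y)) <=
    euclid_dist (plane_point (l * d x y) 0) (plane_point u v).
  rewrite metric_sym; apply: H.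
  - by rewrite mulr_ge0 ?dist_ge0 //= ler_piMl ?dist_ge0.
  - by rewrite dist_ge0 lexx.
  - split.
      exists l => //; apply/rowP => k; rewrite !mxE.
      by case: ifP => _; ring.
    rewrite euclid_dist_plane; apply: sqrt_sq_eq; [by rewrite mulr_ge0 ?dist_ge0 | ring].
  - split => //; exists 1; first by rewrite ler01 lexx.
    by rewrite subrr scale0r add0r scale1r.
apply: le_trans (_ : euclid_dist (plane_point (l * d x y) 0) (plane_point u v) ^+ 2 <= _).
  by rewrite lerXn2r // ?nnegrE ?dist_ge0 ?sqrtr_ge0.
rewrite euclid_dist_plane sqr_sqrtr ?addr_ge0 ?sqr_ge0 //.
rewrite [leLHS](_ : _ = l ^+ 2 * d x y ^+ 2 - l * (2 * d x y * u)
  + u ^+ 2 + v ^+ 2); last by ring.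
rewrite uE vE le_eqVlt; apply/orP; left; apply/eqP; ring.
Qed.

End comparison.

(** * Convexity of the metric *)

Section convexity.
Context {R : realType} {M : metricType R}.
Hypothesis catM : CAT0 M.
Implicit Types x y z p : M.

Local Notation d := (@mdist R M).

Lemma le_of_sqr (a b : R) : 0 <= b -> a ^+ 2 <= b ^+ 2 -> a <= b.
Proof.
move=> b0 ab; have [a0|a0] := leP 0 a; last exact: le_trans (ltW a0) b0.
by rewrite -(@ler_pXn2r _ 2) ?nnegrE.
Qed.

(** The geodesic is a choice, but [comb_unique] shows that the point does not depend on it. *)
Definition comb (l : R) x y : M := projT1 (cid (catM.1 x y)) (l * d x y).

Lemma combP l x y z : 0 <= l <= 1 ->
  d z (comb l x y) ^+ 2 <=
  (1 - l) * d z x ^+ 2 + l * d z y ^+ 2 - l * (1 - l) * d x y ^+ 2.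
Proof. by rewrite /comb; case: cid => c /= cP; apply: CAT0_segment. Qed.

Lemma scaled_range l x y : 0 <= l <= 1 -> 0 <= l * d x y <= d x y.
Proof.
by move=> /andP[l0 l1]; rewrite mulr_ge0 ?dist_ge0 //= ler_piMl ?dist_ge0.
Qed.

Lemma dist_comb_l l x y : 0 <= l <= 1 -> d x (comb l x y) = l * d x y.
Proof.
move=> /[dup] /andP[l0 l1] l01; rewrite /comb; case: cid => c /= [c0 _ cP].
rewrite -{1}c0 cP ?scaled_range ?lexx ?dist_ge0 // sub0r normrN ger0_norm //.
by rewrite mulr_ge0 ?dist_ge0.
Qed.

Lemma dist_comb_r l x y : 0 <= l <= 1 -> d (comb l x y) y = (1 - l) * d x y.
Proof.
move=> /[dup] /andP[l0 l1] l01; rewrite /comb; case: cid => c /= [_ c1 cP].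
rewrite -[X in d _ X]c1 cP ?scaled_range ?lexx ?dist_ge0 // distrC.
rewrite [X in `|X|](_ : _ = (1 - l) * d x y); last by ring.
by rewrite ger0_norm // mulr_ge0 ?dist_ge0 ?subr_ge0.
Qed.

(** With these two bounds the right side of [combP] collapses to 0. *)
Lemma comb_unique l x y z : 0 <= l <= 1 -> d x z <= l * d x y ->
  d z y <= (1 - l) * d x y -> z = comb l x y.
Proof.
move=> /[dup] /andP[l0 l1] l01 xz zy; apply: dist_eq0; apply/eqP.
rewrite -sqrf_eq0 eq_le sqr_ge0 andbT; apply: le_trans (combP x y z l01) _.
rewrite metric_sym in xz.
have : d z x ^+ 2 <= (l * d x y) ^+ 2.
  by rewrite lerXn2r ?nnegrE ?dist_ge0 ?mulr_ge0 ?dist_ge0.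
have : d z y ^+ 2 <= ((1 - l) * d x y) ^+ 2.
  by rewrite lerXn2r ?nnegrE ?dist_ge0 ?mulr_ge0 ?dist_ge0 ?subr_ge0.
move=> /(ler_wpM2l l0) h1 /(@ler_wpM2l _ (1 - l)) h2.
have {}h2 := h2 (ltac:(by rewrite subr_ge0)).
apply: le_trans (lerB (lerD h2 h1) (lexx _)) _.
by rewrite le_eqVlt; apply/orP; left; apply/eqP; ring.
Qed.

Lemma comb0 x y : comb 0 x y = x.
Proof.
by symmetry; apply: comb_unique; rewrite ?lexx ?ler01 // ?mdistxx ?mul0r // subr0 mul1r.
Qed.

Lemma combC l x y : 0 <= l <= 1 -> comb l x y = comb (1 - l) y x.
Proof.
move=> /[dup] /andP[l0 l1] l01; apply: comb_unique; first by apply/andP; split; lra.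
  by rewrite metric_sym dist_comb_r // (metric_sym x).
by rewrite metric_sym dist_comb_l // (metric_sym x) opprB addrCA subrr addr0.
Qed.

Lemma combxx l x : 0 <= l <= 1 -> comb l x x = x.
Proof.
by move=> l01; apply/esym/comb_unique; rewrite // mdistxx mulr0.
Qed.

Lemma segment_comb x y c t : geodesic_segment x y c -> 0 <= t <= d x y ->
  c t = comb (t / d x y) x y.
Proof.
move=> cP /andP[t0 t1]; have [c0 c1 cd] := cP.
have [xy0|xyN0] := eqVneq (d x y) 0.
  by rewrite xy0 invr0 mulr0 comb0 -c0; congr c; apply/eqP; rewrite eq_le t0 -xy0 t1.
have xyp : 0 < d x y by rewrite lt_neqAle eq_sym xyN0 dist_ge0.
have l01 : 0 <= t / d x y <= 1.
  by rewrite divr_ge0 ?dist_ge0 //= ler_pdivrMr // mul1r.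
apply: comb_unique => //.
- rewrite -{1}c0 cd ?lexx ?dist_ge0 ?t0 ?t1 // sub0r normrN ger0_norm //.
  by rewrite divfK.
- rewrite -[X in d _ X]c1 cd ?lexx ?dist_ge0 ?t0 ?t1 // distrC ger0_norm ?subr_ge0 //.
  by rewrite mulrBl mul1r divfK.
Qed.

(** Two uses of [combP]: on the segment from p to y seen from [comb l p x], then on the segment from
    p to x seen from y. The terms in [d p x] and [d p y] cancel. *)
Lemma comb_common l p x y : 0 <= l <= 1 ->
  d (comb l p x) (comb l p y) <= l * d x y.
Proof.
move=> /[dup] /andP[l0 l1] l01; apply: le_of_sqr.
  by rewrite mulr_ge0 ?dist_ge0.
apply: le_trans (combP p y _ l01) _.
rewrite (metric_sym _ p) (metric_sym _ y) dist_comb_l //.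
have /(ler_wpM2l l0) H := combP p x y l01.
rewrite (metric_sym y p) (metric_sym y x) in H.
apply: le_trans (lerB (lerD (lexx _) H) (lexx _)) _.
by rewrite le_eqVlt; apply/orP; left; apply/eqP; ring.
Qed.

(** The quadrilateral is cut along the diagonal from x to y', and [comb_common] applies to each
    half. *)
Lemma comb_convex l x y x' y' : 0 <= l <= 1 ->
  d (comb l x y) (comb l x' y') <= (1 - l) * d x x' + l * d y y'.
Proof.
move=> /[dup] /andP[l0 l1] l01.
apply: le_trans (metric_triangle _ (comb l x y') _) _.
rewrite addrC lerD ?comb_common //.
rewrite (combC x) // (combC x') // comb_common //; apply/andP; split; lra.
Qed.

Lemma dist_comb_le l x y z : 0 <= l <= 1 ->
  d z (comb l x y) <= (1 - l) * d z x + l * d z y.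
Proof. by move=> l01; rewrite -{1}(combxx z l01) comb_convex. Qed.

Lemma comb_isometry g l x y : is_isometry g -> 0 <= l <= 1 ->
  g (comb l x y) = comb l (g x) (g y).
Proof.
by move=> [_ gd] l01; apply: comb_unique; rewrite // !gd ?dist_comb_l ?dist_comb_r.
Qed.

Lemma half01 : 0 <= (2^-1 : R) <= 1.
Proof. by apply/andP; split; lra. Qed.

(** Let m be the midpoint of x and z. Add [combP] seen from y and from w, and bound [d y w ^+ 2] by
    twice the sum of the squared distances from m to y and w. *)
Lemma quadrilateral x y z w :
  d x z ^+ 2 + d y w ^+ 2 <=
  d x y ^+ 2 + d y z ^+ 2 + d z w ^+ 2 + d w x ^+ 2.
Proof.
have h1 := combP x z y half01; have h2 := combP x z w half01.
set m := comb _ _ _ in h1 h2.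
have t := metric_triangle y m w.
have : d y w ^+ 2 <= (d y m + d m w) ^+ 2.
  by rewrite lerXn2r ?nnegrE ?addr_ge0 ?dist_ge0.
have := sqr_ge0 (d y m - d m w).
rewrite (metric_sym w m) in h2; rewrite (metric_sym y x) (metric_sym w z) in h1 h2 *.
nra.
Qed.

End convexity.

(** * Limits of sequences of points *)

Section limits.
Context {R : realType}.

Lemma dist_lim_le (M : metricType R) (u v : nat -> M) x y (K : R) :
  u @ \oo --> x -> v @ \oo --> y ->
  (\forall n \near \oo, mdist (u n) (v n) <= K) -> mdist x y <= K.
Proof.
move=> ux vy uvK; apply/ler_addgt0Pr => e e0.
have e2 : 0 < e / 2 by rewrite divr_gt0.
near \oo => n.
have h1 : mdist x (u n) <= e / 2
  by near: n; exact: (metricType_numDomainType.cvgr_dist_le ux e2).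
have h2 : mdist y (v n) <= e / 2
  by near: n; exact: (metricType_numDomainType.cvgr_dist_le vy e2).
have h3 : mdist (u n) (v n) <= K by near: n.
have t1 := metric_triangle x (u n) y; have t2 := metric_triangle (u n) (v n) y.
rewrite (metric_sym (v n)) in t2; lra.
Unshelve. all: by end_near. Qed.

Lemma dist_lim_ge (M : metricType R) (u v : nat -> M) x y (K : R) :
  u @ \oo --> x -> v @ \oo --> y ->
  (\forall n \near \oo, K <= mdist (u n) (v n)) -> K <= mdist x y.
Proof.
move=> ux vy uvK; apply/ler_addgt0Pr => e e0.
have e2 : 0 < e / 2 by rewrite divr_gt0.
near \oo => n.
have h1 : mdist x (u n) <= e / 2
  by near: n; exact: (metricType_numDomainType.cvgr_dist_le ux e2).
have h2 : mdist y (v n) <= e / 2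
  by near: n; exact: (metricType_numDomainType.cvgr_dist_le vy e2).
have h3 : K <= mdist (u n) (v n) by near: n.
have t1 := metric_triangle (u n) x (v n); have t2 := metric_triangle x y (v n).
rewrite (metric_sym _ x) in t1; lra.
Unshelve. all: by end_near. Qed.

Lemma dist_lim_eq (M : metricType R) (u v : nat -> M) x y (K : R) :
  u @ \oo --> x -> v @ \oo --> y ->
  (\forall n \near \oo, mdist (u n) (v n) = K) -> mdist x y = K.
Proof.
move=> ux vy uvK; apply/eqP; rewrite eq_le; apply/andP; split.
  by apply: dist_lim_le ux vy _; apply: filterS uvK => n ->.
by apply: dist_lim_ge ux vy _; apply: filterS uvK => n ->.
Qed.

Lemma isometry_cvg (M : metricType R) (g : M -> M) (u : nat -> M) x :
  is_isometry g -> u @ \oo --> x -> g \o u @ \oo --> g x.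
Proof.
move=> [_ gd] /metricType_numDomainType.cvgrPdist_le ux.
apply/metricType_numDomainType.cvgrPdist_le => e /ux.
by apply: filterS => n; rewrite /= gd.
Qed.

Lemma cauchy_dist_cvg (M : completeMetricType R) (u : nat -> M) :
  (forall e : R, 0 < e -> exists N, forall m n,
    (N <= m)%N -> (N <= n)%N -> mdist (u m) (u n) <= e) ->
  exists x : M, u @ \oo --> x.
Proof.
move=> H; suff : cvg (u @ \oo) by move=> /cvg_ex.
apply/cauchy_cvgP/cauchy_exP => e e0.
have [N HN] := H (e / 2) (ltac:(by rewrite divr_gt0)).
exists (u N); exists N => // n /= Nn; rewrite ballEmdist /=.
by apply: le_lt_trans (HN _ _ _ Nn) _ => //; lra.
Qed.

End limits.

(** * Growth of the displacement under iteration *)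

Section translation.
Context {R : realType} {M : metricType R}.
Hypothesis catM : CAT0 M.
Local Notation d := (@mdist R M).

Lemma iter_isometry (g : M -> M) n : is_isometry g -> is_isometry (iter n g).
Proof.
move=> [gb gd]; elim: n => [|n [nb nd]] /=; first by split => //; exists id.
by split => [|x y]; [exact: bij_comp | rewrite gd nd].
Qed.

(* The isometry moves the midpoint of [p, g p] to that of [g p, g (g p)]. *)
Lemma displacement_square (g : M -> M) (l : R) : is_isometry g ->
  (forall p, l <= d p (g p)) -> forall p, 2 * l <= d p (g (g p)).
Proof.
move=> gi lg p; have := lg (comb catM 2^-1 p (g p)).
rewrite (comb_isometry catM _ _ gi) ?half01 //.
rewrite (combC catM p) ?half01 // [X in comb _ X (g p)](_ : _ = 2^-1 :> R); last by lra.
have := comb_common catM (g p) p (g (g p)) half01.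
lra.
Qed.

(** The midpoint argument only doubles the exponent, so the rate of escape is studied along powers
    of two. *)
Lemma displacement_pow2 (g : M -> M) (l : R) : is_isometry g ->
  (forall p, l <= d p (g p)) ->
  forall k p, l * (2 ^ k)%:R <= d p (iter (2 ^ k) g p).
Proof.
move=> gi lg; elim=> [|k IH] p; first by rewrite expn0 mulr1 lg.
have := displacement_square (iter_isometry (2 ^ k) gi) IH p.
by rewrite -iterD addnn -mul2n -expnS expnS natrM mulrCA.
Qed.

Lemma dist_iter_sub (g : M -> M) m n p : is_isometry g -> (m <= n)%N ->
  d (iter m g p) (iter n g p) = d p (iter (n - m) g p).
Proof.
by move=> gi mn; rewrite -{1}(subnKC mn) iterD (iter_isometry m gi).2.
Qed.

(** By the triangle inequality the quotients [r k] do not increase with k, so their infimum L is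
    also their limit. *)
Lemma drift_rate (g : M -> M) (l : R) p : is_isometry g ->
  (forall p, l <= d p (g p)) ->
  exists L : R, [/\ l <= L, (forall k, L * (2 ^ k)%:R <= d p (iter (2 ^ k) g p)) &
    forall e, 0 < e -> exists k0, forall k, (k0 <= k)%N ->
      d p (iter (2 ^ k) g p) <= (L + e) * (2 ^ k)%:R].
Proof.
move=> gi lg; pose r k := d p (iter (2 ^ k) g p) / (2 ^ k)%:R.
have pos k : 0 < (2 ^ k)%:R :> R by rewrite ltr0n expn_gt0.
have lb : lbound (range r) l.
  by move=> _ [k _ <-]; rewrite ler_pdivlMr //; exact: displacement_pow2.
have hi : has_inf (range r) by split; [exists (r 0); exists 0%N | exists l].
exists (inf (range r)); split.
- by apply: lb_le_inf lb; exists (r 0); exists 0%N.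
- move=> k; rewrite -ler_pdivlMr //; apply: ge_inf; last by exists k.
  by exists l.
- move=> e e0; have [_ [k0 _ <-] hk0] := inf_adherent e0 hi.
  exists k0 => k /subnKC <-; rewrite -ler_pdivrMr // -/(r _).
  apply: le_trans (ltW hk0).
  elim: (k - k0)%N => [|j IH]; first by rewrite addn0.
  rewrite addnS; apply: le_trans IH.
  rewrite /r ler_pdivrMr // expnS natrM mulrCA divfK ?gt_eqF //.
  rewrite mul2n -addnn iterD.
  apply: le_trans (metric_triangle _ (iter (2 ^ (k0 + j)) g p) _) _.
  by rewrite (iter_isometry _ gi).2 mulr_natl mulr2n.
Qed.

End translation.

(** Take n with [b n] above the sum of the absolute values of the first m terms. A maximum over the
    indices up to n cannot then occur before m. *)
Lemma unbounded_record {R : realType} (b : nat -> R) m :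
  (forall B, exists n, B < b n) ->
  exists2 N, (m <= N)%N & forall i, (i <= N)%N -> b i <= b N.
Proof.
move=> bu; have [n bn] := bu (\sum_(i < m) `|b i|).
have [N _ HN] : exists2 N : 'I_n.+1, true & forall i : 'I_n.+1, b i <= b N.
  by case: (@arg_maxP _ _ _ ord0 xpredT (fun i : 'I_n.+1 => b i) isT) => N _ H;
    exists N => // i; apply: H.
exists N => [|i iN].
  rewrite leqNgt; apply/negP => Nm.
  have := HN ord_max; rewrite leNgt => /negP; apply; apply: le_lt_trans bn.
  apply: le_trans (ler_norm _) _.
  by rewrite (bigD1 (Ordinal Nm)) //= lerDl sumr_ge0.
exact: (HN (Ordinal (leq_ltn_trans iN (ltn_ord N)))).
Qed.

(** * The ray tracked by an orbit *)

Section drift_ray.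
Context {R : realType} {M : completeMetricType R}.
Hypothesis catM : CAT0 M.
Local Notation d := (@mdist R M).

Lemma comb_comb (l l' : R) (p x : M) : 0 <= l <= 1 -> 0 <= l' <= 1 ->
  comb catM l p (comb catM l' p x) = comb catM (l * l') p x.
Proof.
move=> /[dup] /andP[l0 l1] l01 /[dup] /andP[m0 m1] m01.
apply: comb_unique.
- by rewrite mulr_ge0 //= mulr_ile1.
- by rewrite dist_comb_l // dist_comb_l // mulrA.
apply: le_trans (metric_triangle _ (comb catM l' p x) _) _.
by rewrite !dist_comb_r // dist_comb_l // le_eqVlt; apply/orP; left; apply/eqP; ring.
Qed.

Lemma dist_comb_comb (l l' : R) (x y : M) : 0 <= l <= 1 -> 0 <= l' <= 1 ->
  d (comb catM l x y) (comb catM l' x y) = `|l - l'| * d x y.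
Proof.
move=> l01 l01'; rewrite /comb; case: cid => c /= [_ _ cd].
by rewrite cd ?scaled_range // -mulrBl normrM (ger0_norm (dist_ge0 _ _)).
Qed.

Variables (g : M -> M) (p : M) (L : R).
Hypothesis g_isometry : is_isometry g.
Hypothesis L_gt0 : 0 < L.
Local Notation a n := (d p (iter n g p)).
Hypothesis drift_ge : forall k, L * (2 ^ k)%:R <= a (2 ^ k).
Hypothesis drift_le : forall e, 0 < e -> exists k0, forall k, (k0 <= k)%N ->
  a (2 ^ k) <= (L + e) * (2 ^ k)%:R.

Let seg N t := comb catM (t / a N) p (iter N g p).

(** Records of [a i - (L - e) * i], which is unbounded because it is at least [e * 2 ^ k] at the
    index [2 ^ k]. *)
Lemma record_time (e : R) m : 0 < e ->
  exists2 N, (m <= N)%N &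
    forall i, (i <= N)%N -> (L - e) * (N%:R - i%:R) <= a N - a i.
Proof.
move=> e0.
have [B|N mN HN] := @unbounded_record _ (fun i => a i - (L - e) * i%:R) m.
  have [k Bk] : exists k, B < e * (2 ^ k)%:R.
    exists (Num.bound `|B / e|); rewrite mulrC -ltr_pdivrMr //.
    apply: le_lt_trans (ler_norm _) _.
    apply: lt_le_trans (archi_boundP (normr_ge0 _)) _.
    by rewrite ler_nat ltnW // ltn_expl.
  exists (2 ^ k)%N; have := drift_ge k; lra.
by exists N => // i iN; have := HN i iN; lra.
Qed.

(* Squared comparison at the point of [p, g^N p] at distance (1 - dl^2) L n:
   the record condition bounds d(g^n p, g^N p) by the length of the remaining
   piece of the segment. *)
Lemma record_tracking (dl : R) N n : 0 < dl -> dl <= 1 -> (n <= N)%N ->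
  (forall i, (i <= N)%N ->
    (1 - dl ^+ 2) * L * (N%:R - i%:R) <= a N - a i) ->
  a n <= (1 + dl ^+ 2) * L * n%:R ->
  (1 - dl ^+ 2) * L * n%:R <= a N /\
  d (iter n g p) (seg N ((1 - dl ^+ 2) * L * n%:R)) <= 2 * L * dl * n%:R.
Proof.
move=> dl0 dl1 nN rec an.
set s := (1 - dl ^+ 2) * L * n%:R.
have n0 : 0 <= n%:R :> R by [].
have dl2 : dl ^+ 2 <= 1 by rewrite expr_le1 // ltW.
have s0 : 0 <= s by rewrite /s !mulr_ge0 // ?subr_ge0 // ltW.
(* The record condition is used at N - n because d(g^n p, g^N p) equals [a (N - n)]. *)
have h1 := rec _ (leq_subr n N).
have h0 := dist_ge0 p (iter (N - n) g p).
have sN : d (iter n g p) (iter N g p) <= a N - s.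
  rewrite dist_iter_sub //; move: h1; rewrite natrB // /s; lra.
have saN : s <= a N by have := dist_ge0 (iter n g p) (iter N g p); lra.
split => //.
have [aN0|aN0] := eqVneq (a N) 0.
  have s00 : s = 0 by apply/eqP; rewrite eq_le s0 -aN0 saN.
  rewrite /seg s00 mul0r comb0 metric_sym.
  apply: le_trans (_ : d (iter n g p) (iter N g p) + d p (iter N g p) <= _).
    by rewrite metric_sym (metric_sym p (iter N g p)); exact: metric_triangle.
  rewrite aN0 addr0; apply: le_trans sN _; rewrite aN0 s00 subrr.
  by rewrite !mulr_ge0 // ltW.
have aNp : 0 < a N by rewrite lt_neqAle eq_sym aN0 dist_ge0.
have l01 : 0 <= s / a N <= 1.
  by rewrite divr_ge0 ?dist_ge0 //= ler_pdivrMr // mul1r.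
have := combP catM p (iter N g p) (iter n g p) l01.
rewrite -/(seg N s) (metric_sym _ p).
have sE : s / a N * a N = s by rewrite divfK.
move: (seg N s) l01 sE; set l := s / a N; move=> q /andP[l0 l1] sE hq.
apply: le_of_sqr; first by rewrite !mulr_ge0 // ltW.
apply: le_trans hq _.
have an2 : a n ^+ 2 <= ((1 + dl ^+ 2) * L * n%:R) ^+ 2.
  by rewrite lerXn2r ?nnegrE ?dist_ge0 // (le_trans (dist_ge0 _ _) an).
have sN2 : d (iter n g p) (iter N g p) ^+ 2 <= ((1 - l) * a N) ^+ 2.
  rewrite lerXn2r ?nnegrE ?dist_ge0 // ?mulr_ge0 ?subr_ge0 ?dist_ge0 //.
  by rewrite mulrBl mul1r sE.
have l1' : 0 <= 1 - l by rewrite subr_ge0.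
have H1 := ler_wpM2l l1' an2; have H2 := ler_wpM2l l0 sN2.
apply: le_trans (_ : (1 - l) * (2 * L * dl * n%:R) ^+ 2 <= _); last first.
  by rewrite ler_piMl ?sqr_ge0 // gerBl.
(* From (1 + x)^2 - (1 - x)^2 = 4 x with x = dl^2; the square in the defect makes the final error
   linear in [dl]. *)
have -> : (2 * L * dl * n%:R) ^+ 2 = ((1 + dl ^+ 2) * L * n%:R) ^+ 2 - (l * a N) ^+ 2.
  by rewrite sE /s; ring.
apply: le_trans (lerB (lerD H1 H2) (lexx _)) _.
by rewrite le_eqVlt; apply/orP; left; apply/eqP; ring.
Qed.


Lemma pow2_large (t c : R) k0 : 0 < c ->
  exists2 k, (k0 <= k)%N & t <= c * (2 ^ k)%:R.
Proof.
move=> c0; exists (maxn k0 (Num.bound `|t / c|)); first exact: leq_maxl.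
rewrite mulrC -ler_pdivrMr //; apply: le_trans (ler_norm _) _.
apply: le_trans (ltW (archi_boundP (normr_ge0 _))) _.
rewrite ler_nat; apply: leq_trans (leq_maxr k0 _) _.
by rewrite ltnW // ltn_expl.
Qed.

(** Both points at distance t lie at the fraction t / s of segments issuing from the same p, so
    [comb_common] applies. *)
Lemma seg_scale N N' s t : 0 <= t -> t <= s -> 0 < s -> s <= a N -> s <= a N' ->
  d (seg N t) (seg N' t) <= t / s * d (seg N s) (seg N' s).
Proof.
move=> t0 ts s0 sN sN'.
have ts01 : 0 <= t / s <= 1.
  by rewrite ler_pdivrMr // mul1r ts andbT divr_ge0 // ltW.
suff E n : s <= a n -> seg n t = comb catM (t / s) p (seg n s).
  by rewrite !E // comb_common.
move=> sn; have an : 0 < a n by apply: lt_le_trans sn.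
rewrite /seg comb_comb //; last first.
  by rewrite ler_pdivrMr // mul1r sn andbT divr_ge0 // ltW.
by rewrite mulrA divfK // gt_eqF.
Qed.

Lemma drift_ray : exists c : R -> M, [/\ geodesic_ray c,
  (forall t, 0 <= t -> d (c t) (g (c t)) <= d p (g p)) &
  forall dl, 0 < dl -> dl <= 2^-1 -> exists k0, forall k, (k0 <= k)%N ->
    d (iter (2 ^ k) g p) (c ((1 - dl ^+ 2) * L * (2 ^ k)%:R))
      <= 2 * L * dl * (2 ^ k)%:R].
Proof.
(* Record times tending to infinity, with defects L / (j + 1) tending to 0. *)
have /choice[N HN] : forall j, exists N, (j <= N)%N /\
    forall i, (i <= N)%N -> (L - L / j.+1%:R) * (N%:R - i%:R) <= a N - a i.
  move=> j; have [|N jN HN] := @record_time (L / j.+1%:R) j; last by exists N.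
  by rewrite divr_gt0.
(* For a fixed large k, all sufficiently late records satisfy the hypotheses of [record_tracking]
   with n = 2^k. *)
have stage dl : 0 < dl -> dl <= 2^-1 -> exists k0, forall k, (k0 <= k)%N ->
    \forall j \near \oo, (1 - dl ^+ 2) * L * (2 ^ k)%:R <= a (N j) /\
    d (iter (2 ^ k) g p) (seg (N j) ((1 - dl ^+ 2) * L * (2 ^ k)%:R))
      <= 2 * L * dl * (2 ^ k)%:R.
  move=> dl0 dl2; have dlq : 0 < dl ^+ 2 by rewrite exprn_gt0.
  have [k0 Hk0] := drift_le (mulr_gt0 dlq L_gt0).
  exists k0 => k k0k.
  exists (maxn (Num.bound (dl ^+ 2)^-1) (2 ^ k)) => // j /=.
  rewrite geq_max => /andP[j1 j2]; have [jN rec] := HN j.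
  apply: record_tracking => //; first by lra.
  - exact: leq_trans jN.
  - move=> i iN; apply: le_trans (rec i iN).
    have jdl : j.+1%:R^-1 <= dl ^+ 2.
      rewrite -[leRHS]invrK lef_pV2 ?posrE ?invr_gt0 //.
      apply: le_trans (ltW (archi_boundP _)) _; first by rewrite invr_ge0 ltW.
      by rewrite ler_nat leqW.
    have iN' : 0 <= (N j)%:R - i%:R :> R by rewrite subr_ge0 ler_nat.
    move: (j.+1%:R^-1) jdl (_ - _) iN' => u udl v v0.
    have := ler_wpM2r v0 (ler_wpM2l (ltW L_gt0) udl); lra.
  - by rewrite mulrDl mul1r; exact: Hk0.
(* The bound 1/2 on [dl] keeps 1 - dl^2 above 3/4, so the tracked length grows with k at a rate
   independent of [dl]. *)
have long dl : dl <= 2^-1 -> 0 < dl -> 3 / 4 * L <= (1 - dl ^+ 2) * L.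
  by move=> dl2 dl0; apply: (ler_wpM2r (ltW L_gt0)); nra.
have half0 : 0 < (2^-1 : R) by rewrite invr_gt0.
have c34 : 0 < 3 / 4 * L by rewrite mulr_gt0 // divr_gt0.
have grow t : \forall j \near \oo, t <= a (N j).
  have [k0 Hk0] := stage _ half0 (lexx _).
  have [k kk0 tk] := pow2_large t k0 c34.
  apply: filterS (Hk0 k kk0) => j [H _]; apply: le_trans tk (le_trans _ H).
  by apply: ler_wpM2r => //; exact: long.
have in01 n t : 0 <= t -> 0 < a n -> t <= a n -> 0 <= t / a n <= 1.
  by move=> t0 n0 tn; rewrite divr_ge0 ?dist_ge0 //= ler_pdivrMr // mul1r.
have /choice[c Hc] : forall t : R, exists x : M,
    0 <= t -> (fun j => seg (N j) t) @ \oo --> x.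
  (* For negative t the value p is a default that a ray never sees. *)
  move=> t; have [t0|t0] := leP 0 t; last by exists p.
  have [|x Hx] := @cauchy_dist_cvg _ M (fun j => seg (N j) t); last by exists x.
  move=> e e0.
  have t1 : 0 < t + 1 by lra.
  (* At length s two late segments differ by at most 4 L dl 2^k, which is below 6 dl s since s is at
     least 3/4 L 2^k. Scaling down to t leaves 6 dl t; the t + 1 avoids a division by 0. *)
  pose dl := Num.min 2^-1 (e / (6 * (t + 1))).
  have dl0 : 0 < dl by rewrite lt_min half0 divr_gt0 // mulr_gt0.
  have dl2 : dl <= 2^-1 by rewrite ge_min lexx.
  have dle : dl * (6 * (t + 1)) <= e.
    by rewrite -ler_pdivlMr ?mulr_gt0 // ge_min lexx orbT.
  have [k0 Hk0] := stage dl dl0 dl2.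
  have [k kk0 tk] := pow2_large t k0 c34.
  have sL := long dl dl2 dl0.
  have n0 : 0 < (2 ^ k)%:R :> R by rewrite ltr0n expn_gt0.
  have [J _ HJ] := Hk0 k kk0; exists J => i j Ji Jj.
  have [ai di] := HJ i Ji; have [aj dj] := HJ j Jj.
  move: ai di aj dj; set s := (1 - _) * L * _ => ai di aj dj.
  have s34 : 3 / 4 * L * (2 ^ k)%:R <= s by rewrite ler_wpM2r // ltW.
  have s0 : 0 < s by apply: lt_le_trans s34; rewrite mulr_gt0.
  have ts : t <= s by apply: le_trans s34.
  apply: le_trans (seg_scale t0 ts s0 ai aj) _.
  have := metric_triangle (seg (N i) s) (iter (2 ^ k) g p) (seg (N j) s).
  rewrite (metric_sym (seg (N i) s) (iter _ _ _)) => tri.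
  have D : d (seg (N i) s) (seg (N j) s) <= 6 * dl * s.
    apply: le_trans tri _; apply: le_trans (lerD di dj) _.
    have := ler_wpM2l (ltW dl0) s34; have := mulr_gt0 (mulr_gt0 L_gt0 dl0) n0; nra.
  apply: le_trans (ler_wpM2l _ D) _; first by rewrite divr_ge0 // ltW.
  rewrite (_ : t / s * _ = 6 * dl * t); last by field; rewrite gt_eqF.
  by apply: le_trans dle; nra.
exists c; split.
- move=> s t s0 t0; apply: dist_lim_eq (Hc s s0) (Hc t t0) _.
  near=> j.
  have sa : s <= a (N j) by near: j.
  have ta : t <= a (N j) by near: j.
  have a0 : 0 < a (N j) by apply: lt_le_trans ltr01 _; near: j.
  rewrite dist_comb_comb ?in01 // -mulrBl normrM normfV.
  by rewrite (ger0_norm (dist_ge0 _ _)) divfK // gt_eqF.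
- move=> t t0.
  apply: dist_lim_le (Hc t t0) (isometry_cvg g_isometry (Hc t t0)) _.
  near=> j.
  have ta : t <= a (N j) by near: j.
  have a0 : 0 < a (N j) by apply: lt_le_trans ltr01 _; near: j.
  have l01 := in01 _ _ t0 a0 ta.
  (* Both ends of the segment from p to g^N p are displaced by d(p, g p), so by convexity every
     point of it is displaced by at most that. *)
  rewrite /= comb_isometry //; apply: le_trans (comb_convex _ _ _ _ _ l01) _.
  rewrite -iterS iterSr (iter_isometry _ g_isometry).2.
  by rewrite -mulrDl subrK mul1r.
- move=> dl dl0 dl2; have [k0 Hk0] := stage dl dl0 dl2.
  exists k0 => k k0k; set s := (1 - _) * L * _.
  have s0 : 0 <= s.
    rewrite /s mulr_ge0 // ltW // (lt_le_trans c34) //; exact: long.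
  apply: dist_lim_le (cvg_cst _) (Hc s s0) _.
  by apply: filterS (Hk0 k k0k) => j [].
Unshelve. all: by end_near. Qed.

End drift_ray.

(** * A line at bounded distance from its image *)

Section line_at_infinity.
Context {R : realType} {M : completeMetricType R}.
Hypothesis catM : CAT0 M.
Local Notation d := (@mdist R M).

Lemma isometry_inverse (g : M -> M) : is_isometry g ->
  exists h, [/\ is_isometry h, cancel g h & cancel h g].
Proof.
move=> [[h gh hg] gd]; exists h; split => //; split; first by exists g.
by move=> x y; rewrite -gd !hg.
Qed.

Lemma iter_cancel (g h : M -> M) n : cancel h g -> cancel (iter n h) (iter n g).
Proof. by move=> hg; elim: n => [//|n IH] x; rewrite iterSr iterS hg IH. Qed.

Lemma dist_iter_inverse (g h : M -> M) m n p : is_isometry g -> cancel h g ->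
  d (iter m g p) (iter n h p) = d p (iter (m + n) g p).
Proof.
move=> gi hg; rewrite -((iter_isometry n gi).2 (iter m g p)) iter_cancel //.
by rewrite -iterD addnC metric_sym.
Qed.

Lemma endpoint_self (c : R -> M) : geodesic_ray c -> endpoint c c.
Proof. by move=> rc; split => //; exists 0 => t _; rewrite mdistxx. Qed.

Lemma displacement_asymptotic (g : M -> M) (c r : R -> M) A :
  is_isometry g -> asymptotic c r ->
  (forall t, 0 <= t -> d (r t) (g (r t)) <= A) ->
  exists K, forall t, 0 <= t -> d (c t) (g (c t)) <= K.
Proof.
move=> gi [K HK] HA; exists (2 * K + A) => t t0.
have := metric_triangle (c t) (r t) (g (c t)).
have := metric_triangle (r t) (g (r t)) (g (c t)).
rewrite gi.2 (metric_sym (r t) (c t)); have := HK t t0; have := HA t t0; lra.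
Qed.

Lemma translated_line (g : M -> M) (l : R) : visible M -> is_isometry g ->
  0 < l -> (forall p, l <= d p (g p)) ->
  exists c, geodesic_line c /\ exists K, forall t, d (c t) (g (c t)) <= K.
Proof.
move=> vis gi l0 lg; have [h [hi gh hg]] := isometry_inverse gi.
pose p : M := point.
have [L [lL La Lb]] := drift_rate catM p gi lg.
have L0 : 0 < L := lt_le_trans l0 lL.
have ah n : d p (iter n h p) = d p (iter n g p).
  exact: (dist_iter_inverse 0 n p gi hg).
have Ha k : L * (2 ^ k)%:R <= d p (iter (2 ^ k) h p) by rewrite ah.
have Hb e : 0 < e -> exists k0, forall k, (k0 <= k)%N ->
    d p (iter (2 ^ k) h p) <= (L + e) * (2 ^ k)%:R.
  by move=> /Lb[k0 Hk0]; exists k0 => k; rewrite ah; exact: Hk0.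
have [c [rc gc tc]] := drift_ray catM gi L0 La Lb.
have [c' [rc' hc tc']] := drift_ray catM hi L0 Ha Hb.
(* With [dl] = 1/4 each ray tracks its orbit up to L n / 2. If the rays stayed within K of each
   other, the points g^n p and g^(-n) p would be at distance at most L n + K, against 2 L n. *)
have quarter : 0 < (4^-1 : R) /\ (4^-1 : R) <= 2^-1 by split; lra.
have ends : endpoint c' <> endpoint c.
  move=> E; have : endpoint c c' by rewrite -E; exact: endpoint_self.
  move=> [_ [K HK]].
  have [k0 Hk] := tc _ quarter.1 quarter.2.
  have [k1 Hk'] := tc' _ quarter.1 quarter.2.
  have [k kk] := pow2_large (K + 1) (maxn k0 k1) L0.
  move: kk; rewrite geq_max => /andP[/Hk h1 /Hk' h2].
  have n0 : 0 <= (2 ^ k)%:R :> R by [].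
  move: h1 h2; set s := (1 - _) * L * _ => h1 h2.
  have s0 : 0 <= s by rewrite /s mulr_ge0 // mulr_ge0 ?(ltW L0) //; lra.
  have := HK s s0; have := La k.+1.
  rewrite expnS natrM mul2n -addnn -(dist_iter_inverse _ _ _ gi hg).
  have := metric_triangle (iter (2 ^ k) g p) (c s) (iter (2 ^ k) h p).
  have := metric_triangle (c s) (c' s) (iter (2 ^ k) h p).
  rewrite (metric_sym (c' s)); nra.
have [//|//|z [lz z' z'']] := vis (endpoint c') (endpoint c) _ _ ends.
- by exists c'.
- by exists c.
exists z; split => //.
have [_ zc] : endpoint z c by rewrite z''; exact: endpoint_self.
have [_ zc'] : endpoint (fun t => z (- t)) c' by rewrite z'; exact: endpoint_self.
have hc' t : 0 <= t -> d (c' t) (g (c' t)) <= d p (h p).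
  by move=> t0; rewrite -hi.2 gh metric_sym; exact: hc.
have [K1 HK1] := displacement_asymptotic gi zc gc.
have [K2 HK2] := displacement_asymptotic gi zc' hc'.
(* The ray [c] controls nonnegative times of the line and [c'] the negative ones. *)
exists (Num.max K1 K2) => t; rewrite le_max.
have [t0|t0] := leP 0 t; first by rewrite HK1.
by have := HK2 (- t); rewrite opprK oppr_ge0 => -> //; rewrite ?orbT // ltW.
Qed.

End line_at_infinity.

(** * Convex functions on the real line *)

Section real_functions.
Context {R : realType}.

(** If f x > f y, then f grows at least linearly from y through and beyond x. The factor [l] is
    chosen so that at y + (x - y) / l the rise above f y is at least 2 (K - f y), which exceeds the
    bound. *)
Lemma bounded_convex_constant (f : R -> R) (K : R) :
  (forall x y l, 0 <= l <= 1 ->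
    f ((1 - l) * x + l * y) <= (1 - l) * f x + l * f y) ->
  (forall x, f x <= K) -> forall x y, f x = f y.
Proof.
move=> cf fK; suff H x y : f x <= f y by move=> x y; apply/eqP; rewrite eq_le !H.
rewrite leNgt; apply/negP => yx.
have dp : 0 < K - f y by have := fK x; lra.
pose l := (f x - f y) / (2 * (K - f y)).
have lE : l * (2 * (K - f y)) = f x - f y by rewrite /l divfK // mulf_neq0 // gt_eqF.
have l0 : 0 < l by rewrite /l divr_gt0 ?mulr_gt0 // subr_gt0.
have l1 : l <= 1.
  by rewrite /l ler_pdivrMr ?mulr_gt0 // mul1r; have := fK x; lra.
have := cf y (y + (x - y) / l) l (ltac:(by rewrite l1 ltW)).
have -> : (1 - l) * y + l * (y + (x - y) / l) = x by field; rewrite gt_eqF.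
have := fK (y + (x - y) / l); nra.
Qed.

(** Applied at - s, the inequality reverses by oddness, so H is homogeneous. *)
Lemma odd_convex_linear (H : R -> R) : (forall s, H (- s) = - H s) ->
  (forall l s, 0 <= l <= 1 -> H (l * s) <= l * H s) ->
  forall s, H s = s * H 1.
Proof.
move=> odd cvx.
have hom l s : 0 <= l <= 1 -> H (l * s) = l * H s.
  move=> l01; apply/eqP; rewrite eq_le cvx //=.
  by have := cvx l (- s) l01; rewrite mulrN !odd mulrN lerN2.
have pos s : 0 <= s -> H s = s * H 1.
  move=> s0; have [s1|s1] := leP s 1.
    by rewrite -{1}(mulr1 s) hom // s0.
  have sp : 0 < s by lra.
  have : H (s^-1 * s) = s^-1 * H s.
    by apply: hom; rewrite invr_ge0 s0 /= invf_le1 // ltW.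
  by rewrite mulVf ?gt_eqF // => ->; rewrite mulrA divff ?gt_eqF // mul1r.
move=> s; have [s0|s0] := leP 0 s; first exact: pos.
by rewrite -[s]opprK odd pos ?mulNr // oppr_ge0 ltW.
Qed.

End real_functions.

(** * Parallel lines *)

Section parallel_lines.
Context {R : realType} {M : metricType R}.
Hypothesis catM : CAT0 M.
Local Notation d := (@mdist R M).
Local Notation comb := (comb catM).
Implicit Types c : R -> M.

Definition parallel (c1 c2 : R -> M) := exists K, forall t, d (c1 t) (c2 t) <= K.

(* Parallel lines whose parameters correspond under projection: equal
   Busemann functions at equal times. *)
Definition synchronous (c1 c2 : R -> M) :=
  forall s t, d (c1 s) (c2 t) ^+ 2 = (s - t) ^+ 2 + d (c1 0) (c2 0) ^+ 2.

Lemma line_comb (c : R -> M) s t l : geodesic_line c -> 0 <= l <= 1 ->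
  c ((1 - l) * s + l * t) = comb l (c s) (c t).
Proof.
move=> lc /[dup] /andP[l0 l1] l01; apply: comb_unique => //; rewrite !lc.
  by rewrite (_ : s - _ = l * (s - t)); [rewrite normrM ger0_norm | ring].
rewrite (_ : _ - t = (1 - l) * (s - t)); last by ring.
by rewrite normrM ger0_norm ?subr_ge0.
Qed.

Lemma line_shift (c : R -> M) a : geodesic_line c -> geodesic_line (fun t => c (t + a)).
Proof. by move=> lc s t; rewrite lc; congr `|_|; ring. Qed.

(* F(s - t) = d(c1 s, c2 t) is well defined because bounded convex functions
   are constant; F(s)^2 - s^2 is convex by the CAT(0) inequality, and its even
   part is constant by the quadrilateral inequality, so it is affine. *)
Lemma parallel_dist c1 c2 : geodesic_line c1 -> geodesic_line c2 ->
  parallel c1 c2 -> exists k D, forall s t,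
  d (c1 s) (c2 t) ^+ 2 = (s - t) ^+ 2 + 2 * k * (s - t) + D.
Proof.
move=> l1 l2 [K HK]; pose F s := d (c1 s) (c2 0).
have FE s t : d (c1 s) (c2 t) = F (s - t).
  have := @bounded_convex_constant _ (fun r => d (c1 (r + (s - t))) (c2 r))
    (`|s - t| + K) _ _ t 0.
  rewrite add0r subrKC; apply => [x y l l01|x].
    have -> : (1 - l) * x + l * y + (s - t) =
      (1 - l) * (x + (s - t)) + l * (y + (s - t)) by ring.
    by rewrite !line_comb // comb_convex.
  apply: le_trans (metric_triangle _ (c1 x) _) _; apply: lerD => //.
  by rewrite l1 (_ : _ - x = s - t) //; ring.
pose G s := F s ^+ 2 - s ^+ 2; pose H s := G s - G 0.
have Gcvx l s t : 0 <= l <= 1 -> G ((1 - l) * s + l * t) <= (1 - l) * G s + l * G t.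
  move=> l01; have := combP catM (c1 s) (c1 t) (c2 0) l01.
  rewrite -line_comb // !(metric_sym (c2 0)) l1 real_normK ?num_real //.
  rewrite /G /F; set A := d _ _; set B := d (c1 s) _; set C := d (c1 t) _; lra.
have Hodd s : H (- s) = - H s.
  have := quadrilateral catM (c1 0) (c1 s) (c2 s) (c2 0).
  rewrite l1 l2 (metric_sym (c2 0)) !FE !subrr sub0r subr0 normrN.
  rewrite real_normK ?num_real // => q.
  have := Gcvx 2^-1 s (- s) half01; rewrite (_ : _ * s + _ = 0); last by lra.
  rewrite /H /G expr0n /= sqrrN => h.
  by apply/eqP; rewrite eq_le; apply/andP; split; lra.
have Hlin := odd_convex_linear Hodd.
exists (H 1 / 2), (G 0) => s t; rewrite FE.
have : H (s - t) = (s - t) * H 1.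
  apply: Hlin => l r l01; have := Gcvx l 0 r l01.
  by rewrite mulr0 add0r /H; lra.
rewrite {1}/H {1}/G; lra.
Qed.

Lemma synchronous_sym c1 c2 : synchronous c1 c2 -> synchronous c2 c1.
Proof.
move=> c12 s t; rewrite metric_sym c12 (metric_sym (c1 0)).
by congr (_ + _); rewrite -sqrrN opprB.
Qed.

Lemma synchronous_parallel c1 c2 : synchronous c1 c2 -> parallel c1 c2.
Proof.
move=> c12; exists (d (c1 0) (c2 0)) => t; apply: le_of_sqr; first exact: dist_ge0.
by rewrite c12 subrr expr0n add0r.
Qed.

Lemma synchronous_dist c1 c2 t : synchronous c1 c2 -> d (c1 t) (c2 t) = d (c1 0) (c2 0).
Proof.
move=> c12; apply/eqP; rewrite -(@eqrXn2 _ 2) ?dist_ge0 //.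
by rewrite c12 subrr expr0n add0r.
Qed.

Lemma synchronous_shift c1 c2 a : synchronous c1 c2 ->
  synchronous (fun t => c1 (t + a)) (fun t => c2 (t + a)).
Proof.
move=> c12 s t; rewrite c12 !add0r synchronous_dist //.
by congr (_ ^+ 2 + _); ring.
Qed.

Lemma synchronous_isometry g c1 c2 : is_isometry g -> synchronous c1 c2 ->
  synchronous (g \o c1) (g \o c2).
Proof. by move=> [_ gd] c12 s t; rewrite /= !gd. Qed.

Lemma parallel_trans c1 c2 c3 : parallel c1 c2 -> parallel c2 c3 -> parallel c1 c3.
Proof.
move=> [K HK] [K' HK']; exists (K + K') => t.
by apply: le_trans (metric_triangle _ (c2 t) _) _; rewrite lerD.
Qed.

(** Completing the square in [parallel_dist]: shifting one line by k removes the linear term. *)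
Lemma parallel_sync c c' : geodesic_line c -> geodesic_line c' ->
  parallel c c' -> exists a, synchronous c (fun t => c' (t + a)).
Proof.
move=> lc lc' /(parallel_dist lc lc')[k [D HD]]; exists k => s t.
by rewrite !HD; ring.
Qed.

(** For u > 0, the root of u^2 + D^2 is at most u + D^2 / (2 u). *)
Lemma synchronous_near c1 c2 (e : R) : synchronous c1 c2 -> 0 < e ->
  exists2 T, 0 <= T & forall s t, T <= `|s - t| -> d (c1 s) (c2 t) <= `|s - t| + e.
Proof.
move=> c12 e0; exists (d (c1 0) (c2 0) ^+ 2 / (2 * e)).
  by rewrite divr_ge0 ?sqr_ge0 ?mulr_ge0 // ltW.
move=> s t; rewrite ler_pdivrMr ?mulr_gt0 // => H.
apply: le_of_sqr; first by rewrite addr_ge0 // ltW.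
rewrite c12 -(real_normK (num_real (s - t))).
have := sqr_ge0 e; lra.
Qed.

(** By [parallel_dist], d(c1 (T), c2 0) and d(c1 (- T), c2 0) are T + k and T - k up to o(1), so the
    bounds at the two ends force k = 0. This criterion needs only estimates far out on the lines. *)
Lemma synchronousP c1 c2 : geodesic_line c1 -> geodesic_line c2 ->
  parallel c1 c2 ->
  (forall e : R, 0 < e -> exists T0, forall T, T0 <= T ->
     d (c1 T) (c2 0) <= T + e /\ d (c1 (- T)) (c2 0) <= T + e) ->
  synchronous c1 c2.
Proof.
move=> l1 l2 /(parallel_dist l1 l2)[k [D HD]] near.
suff k0 : k = 0.
  by move=> s t; rewrite !HD k0 subrr; ring.
suff H (j : R) : (forall e : R, 0 < e -> exists T0, forall T, T0 <= T -> 0 <= T + e /\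
    T ^+ 2 + 2 * j * T + D <= (T + e) ^+ 2) -> j <= 0.
  apply/eqP; rewrite eq_le -[0 <= k]oppr_le0; apply/andP; split;
    apply: H => e /near[T0 HT]; exists T0 => T /HT[h1 h2].
  - split; first exact: le_trans (dist_ge0 _ _) h1.
    have := HD T 0; rewrite subr0 => <-.
    by rewrite lerXn2r ?nnegrE ?dist_ge0 // (le_trans (dist_ge0 _ _) h1).
  - split; first exact: le_trans (dist_ge0 _ _) h1.
    have := HD (- T) 0; rewrite subr0 sqrrN mulrN mulrN mulNr => <-.
    by rewrite lerXn2r ?nnegrE ?dist_ge0 // (le_trans (dist_ge0 _ _) h1).
move=> Hj; rewrite leNgt; apply/negP => j0.
have [T0 HT] := Hj (j / 2) (ltac:(by rewrite divr_gt0)).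
(* Large enough that j T > j^2 / 4 - D, which contradicts the bound for e = j / 2. *)
pose T := Num.max T0 ((j ^+ 2 + `|D|) / j).
have [_] := HT T (ltac:(by rewrite le_max lexx)).
have : (j ^+ 2 + `|D|) / j <= T by rewrite le_max lexx orbT.
rewrite ler_pdivrMr // => h1.
have := ler_norm (- D); rewrite normrN; have := exprn_gt0 2 j0; lra.
Qed.

(** The criterion [synchronousP] is checked by passing through the middle line at half the time,
    where both legs have length nearly T / 2. *)
Lemma synchronous_trans c1 c c2 : geodesic_line c1 -> geodesic_line c2 ->
  synchronous c1 c -> synchronous c c2 -> synchronous c1 c2.
Proof.
move=> l1 l2 h1 h2; apply: synchronousP => //.
  exact: parallel_trans (synchronous_parallel h1) (synchronous_parallel h2).
move=> e e0; have e2 : 0 < e / 2 by rewrite divr_gt0.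
have [T1 T10 H1] := synchronous_near h1 e2; have [T2 T20 H2] := synchronous_near h2 e2.
exists (2 * (T1 + T2)) => T HT; split.
- apply: le_trans (metric_triangle _ (c (T / 2)) _) _.
  have h : `|T - T / 2| = T / 2 by rewrite ger0_norm; lra.
  have h' : `|T / 2 - 0| = T / 2 by rewrite ger0_norm; lra.
  by have := H1 T (T / 2); have := H2 (T / 2) 0; rewrite h h'; lra.
- apply: le_trans (metric_triangle _ (c (- T / 2)) _) _.
  have h : `|- T - - T / 2| = T / 2 by rewrite ler0_norm; lra.
  have h' : `|- T / 2 - 0| = T / 2 by rewrite ler0_norm; lra.
  by have := H1 (- T) (- T / 2); have := H2 (- T / 2) 0; rewrite h h'; lra.
Qed.

(** Convexity bounds distances from above. From below, the far points c1 (a - T) and c1 (a + T) are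
    2 T apart, and the path between them through m s and m t has outer legs nearly T + s + l (b - a)
    and T - t + l (a - b), whose offsets cancel. Distinct a and b serve segments between points at
    different heights. *)
Lemma comb_line c1 c2 l a b : geodesic_line c1 -> geodesic_line c2 ->
  synchronous c1 c2 -> 0 <= l <= 1 ->
  geodesic_line (fun t => comb l (c1 (a + t)) (c2 (b + t))).
Proof.
move=> l1 l2 c12 /[dup] /andP[l0 l1'] l01.
pose m t := comb l (c1 (a + t)) (c2 (b + t)); rewrite -/m.
suff H s t : s <= t -> d (m s) (m t) = t - s.
  move=> s t; have [st|ts] := leP s t.
    by rewrite H // distrC ger0_norm // subr_ge0.
  by rewrite metric_sym H ?(ltW ts) // ger0_norm // subr_ge0 ltW.
move=> st; apply/eqP; rewrite eq_le; apply/andP; split.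
  apply: le_trans (comb_convex _ _ _ _ _ l01) _.
  rewrite l1 l2 (_ : a + s - (a + t) = - (t - s)); last by ring.
  rewrite (_ : b + s - (b + t) = - (t - s)); last by ring.
  rewrite normrN ger0_norm ?subr_ge0 //; lra.
apply/ler_addgt0Pr => e e0; have e2 : 0 < e / 2 by rewrite divr_gt0.
have [T0 T00 HT] := synchronous_near c12 e2.
pose T := T0 + `|a| + `|b| + `|s| + `|t|.
have := ler_norm a; have := ler_norm (- a); have := ler_norm b; have := ler_norm (- b).
have := ler_norm s; have := ler_norm (- s); have := ler_norm t; have := ler_norm (- t).
rewrite !normrN => t1 t2 s1 s2 b1 b2 a1 a2.
have h1 : d (c1 (a - T)) (m s) <= (T + s) + l * (b - a) + e / 2.
  apply: le_trans (dist_comb_le _ _ _ _ l01) _.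
  rewrite l1 (_ : a - T - (a + s) = - (T + s)); last by ring.
  rewrite normrN ger0_norm; last by rewrite /T; lra.
  have E : `|a - T - (b + s)| = T + s + (b - a) by rewrite ler0_norm /T; lra.
  have := HT (a - T) (b + s); rewrite E => /(_ (ltac:(rewrite /T; lra))) /(ler_wpM2l l0).
  have := ler_wpM2r (ltW e2) l1'; rewrite mul1r; lra.
have h2 : d (c1 (a + T)) (m t) <= (T - t) + l * (a - b) + e / 2.
  apply: le_trans (dist_comb_le _ _ _ _ l01) _.
  rewrite l1 (_ : a + T - (a + t) = T - t); last by ring.
  rewrite ger0_norm; last by rewrite /T; lra.
  have E : `|a + T - (b + t)| = T - t + (a - b) by rewrite ger0_norm /T; lra.
  have := HT (a + T) (b + t); rewrite E => /(_ (ltac:(rewrite /T; lra))) /(ler_wpM2l l0).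
  have := ler_wpM2r (ltW e2) l1'; rewrite mul1r; lra.
have := metric_triangle (c1 (a - T)) (m s) (c1 (a + T)).
have := metric_triangle (m s) (m t) (c1 (a + T)).
rewrite (metric_sym (m t)) l1 (_ : a - T - (a + T) = - (2 * T)); last by ring.
rewrite normrN ger0_norm; last by rewrite /T; lra.
lra.
Qed.

Lemma comb_line_parallel c1 c2 l a b : geodesic_line c1 ->
  synchronous c1 c2 -> 0 <= l <= 1 ->
  parallel c1 (fun t => comb l (c1 (a + t)) (c2 (b + t))).
Proof.
move=> l1 c12 /[dup] /andP[l0 l1'] l01.
exists ((1 - l) * `|a| + l * d (c1 0) (c2 b)) => t.
apply: le_trans (dist_comb_le _ _ _ _ l01) _.
rewrite l1 (_ : t - (a + t) = - a) ?normrN; last by ring.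
rewrite lerD2l ler_wpM2l //; apply: le_of_sqr; first exact: dist_ge0.
by rewrite (c12 t) (c12 0 b) le_eqVlt; apply/orP; left; apply/eqP; ring.
Qed.

Lemma comb_line_synchronous c c1 c2 l : geodesic_line c -> geodesic_line c1 ->
  geodesic_line c2 -> synchronous c c1 -> synchronous c c2 -> 0 <= l <= 1 ->
  geodesic_line (fun t => comb l (c1 t) (c2 t)) /\
  synchronous c (fun t => comb l (c1 t) (c2 t)).
Proof.
move=> lc l1 l2 h1 h2 /[dup] /andP[l0 l1'] l01.
have h12 := synchronous_trans l1 l2 (synchronous_sym h1) h2.
have E : (fun t => comb l (c1 t) (c2 t)) = (fun t => comb l (c1 (0 + t)) (c2 (0 + t))).
  by apply/funext => t; rewrite !add0r.
have lm : geodesic_line (fun t => comb l (c1 t) (c2 t)) by rewrite E; exact: comb_line.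
split => //; apply: synchronousP => //.
  rewrite E;
  exact: parallel_trans (synchronous_parallel h1) (comb_line_parallel _ _ l1 h12 l01).
move=> e e0; have [T1 T10 H1] := synchronous_near h1 e0.
have [T2 T20 H2] := synchronous_near h2 e0.
exists (T1 + T2) => T HT.
have n1 : `|T - 0| = T by rewrite ger0_norm; lra.
have n2 : `|- T - 0| = T by rewrite ler0_norm; lra.
split; apply: le_trans (dist_comb_le _ _ _ _ l01) _.
  have := H1 T 0; have := H2 T 0; rewrite n1 => g2 g1.
  have {}g1 : d (c T) (c1 0) <= T + e by apply: g1; lra.
  have {}g2 : d (c T) (c2 0) <= T + e by apply: g2; lra.
  by nra.
have := H1 (- T) 0; have := H2 (- T) 0; rewrite n2 => g2 g1.
have {}g1 : d (c (- T)) (c1 0) <= T + e by apply: g1; lra.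
have {}g2 : d (c (- T)) (c2 0) <= T + e by apply: g2; lra.
by nra.
Qed.

End parallel_lines.

(** * The restricted metric on a subset *)

Section metric_subset.
Context {R : realType} {M : metricType R}.

(** A named type, so that the cross-section of a flat strip can carry a [metricType] structure;
    boolean membership makes [val] injective. *)
Definition metric_subset (A : set M) := {x : M | x \in A}.

Variable A : set M.

HB.instance Definition _ := Choice.on (metric_subset A).

Let subdist (x y : metric_subset A) := mdist (val x) (val y).

Let subdistxx x : subdist x x = 0.
Proof. exact: mdistxx. Qed.

Let subdist_eq0 x y : subdist x y = 0 -> x = y.
Proof. by move=> /dist_eq0/val_inj. Qed.

Let subdistC x y : subdist x y = subdist y x.
Proof. exact: metric_sym. Qed.

Let subdist_triangle y x z : subdist x z <= subdist x y + subdist y z.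
Proof. exact: metric_triangle. Qed.

HB.instance Definition _ := isMetric.Build R (metric_subset A)
  subdistxx subdist_eq0 subdistC subdist_triangle.

Lemma metric_subset_distE (x y : metric_subset A) : mdist x y = mdist (val x) (val y).
Proof. by []. Qed.

End metric_subset.

(** * The product formed by the parallels of a line *)

Section lines_through_infinity.
Context {R : realType} {M : metricType R}.
Hypothesis catM : CAT0 M.
Local Notation d := (@mdist R M).

(* The union of the lines parallel to c is the metric product of R and the set
   of the points at time 0 of the lines synchronous with c. *)
Lemma synchronous_bounded (c : R -> M) : geodesic_line c ->
  ~ has_infinite_flat_strip M ->
  exists K, forall c1 c2, geodesic_line c1 -> geodesic_line c2 ->
    synchronous c c1 -> synchronous c c2 -> d (c1 0) (c2 0) <= K.
Proof.
move=> lc noflat; apply: contrapT => unb; apply: noflat.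
pose Y : set M := [set z | exists c', [/\ geodesic_line c', synchronous c c' & c' 0 = z]].
have /choice[ln Hln] : forall u : metric_subset Y, exists c' : R -> M,
    [/\ geodesic_line c', synchronous c c' & c' 0 = val u].
  by move=> u; have := valP u; rewrite in_setE.
(* Synchronous lines keep a constant distance, so a line synchronous with c is determined by its
   point at time 0. *)
have lnE (c' : R -> M) : geodesic_line c' -> synchronous c c' ->
    exists u, forall t, ln u t = c' t.
  move=> lc' sc'; have Yc : c' 0 \in Y by rewrite in_setE; exists c'.
  exists (Sub (c' 0) Yc) => t; have [l0 s0 e0] := Hln (Sub (c' 0) Yc).
  have s0' := synchronous_trans catM l0 lc' (synchronous_sym s0) sc'.
  apply: dist_eq0; rewrite (synchronous_dist _ s0').
  by rewrite e0 SubK mdistxx.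
pose f (q : metric_subset Y * R) := ln q.1 q.2.
exists (range f); split; last first.
  exists (metric_subset Y); split.
    move=> K; apply: contrapT => nK; apply: unb; exists K => c1 c2 l1 l2 s1 s2.
    rewrite leNgt; apply/negP => Kc; apply: nK.
    have Y1 : c1 0 \in Y by rewrite in_setE; exists c1.
    have Y2 : c2 0 \in Y by rewrite in_setE; exists c2.
    by exists (Sub (c1 0) Y1), (Sub (c2 0) Y2).
  exists f; split => // -[u s] [v t]; rewrite /f /product_dist /=.
  have [lu su eu] := Hln u; have [lv sv ev] := Hln v.
  apply/esym/sqrt_sq_eq; first exact: dist_ge0.
  rewrite (synchronous_trans catM lu lv (synchronous_sym su) sv) eu ev addrC.
  by rewrite metric_subset_distE.
move=> x y c' [[u a] _ <-] [[v b] _ <-] cP t tP; rewrite /f /= in cP tP *.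
rewrite (segment_comb catM cP tP).
have [lu su eu] := Hln u; have [lv sv ev] := Hln v.
have suv := synchronous_trans catM lu lv (synchronous_sym su) sv.
move: tP; set D := d _ _; move=> /andP[t0 tD].
have l01 : 0 <= t / D <= 1.
  rewrite divr_ge0 ?dist_ge0 //=.
  have [->|D0] := eqVneq D 0; first by rewrite invr0 mulr0.
  by rewrite ler_pdivrMr ?mul1r // lt_neqAle eq_sym D0 dist_ge0.
(* Convexity of the union: the point at fraction t / D lies on a line parallel to c, at its time 0.
   Shifting that line by e makes it synchronous with c and moves the point to time - e. *)
have lm := comb_line catM a b lu lv suv l01.
have pm := parallel_trans (synchronous_parallel su)
  (comb_line_parallel catM a b lu suv l01).
have [e se] := parallel_sync catM lc lm pm.
have [w wE] := lnE _ (line_shift e lm) se.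
exists (w, - e) => //=; rewrite wE; congr (comb catM _ (ln u _) (ln v _)); ring.
Qed.

End lines_through_infinity.

(** * The circumcenter of a family of parallel lines *)

Section invariant_line.
Context {R : realType} {M : completeMetricType R}.
Hypothesis catM : CAT0 M.
Local Notation d := (@mdist R M).

(* The isometry permutes the lines synchronous with c; a minimizing sequence
   for the circumradius of this family converges to an invariant line. *)
Lemma invariant_line (g : M -> M) (c : R -> M) (K : R) : is_isometry g ->
  geodesic_line c -> parallel c (g \o c) ->
  (forall c1 c2, geodesic_line c1 -> geodesic_line c2 ->
    synchronous c c1 -> synchronous c c2 -> d (c1 0) (c2 0) <= K) ->
  exists z a, geodesic_line z /\ forall t, g (z t) = z (t + a).
Proof.
move=> gi lc pc HK; have [h [hi gh hg]] := isometry_inverse gi.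
have lg (f : M -> M) c' b : is_isometry f -> geodesic_line c' ->
    geodesic_line (fun t => f (c' (t + b))).
  by move=> fi lc' s t; rewrite fi.2 (line_shift b lc').
have lgc : geodesic_line (g \o c) by move=> s t; rewrite /= gi.2 lc.
have [a sa] := parallel_sync catM lc lgc pc.
pose S (c' : R -> M) := geodesic_line c' /\ synchronous c c'.
(* The shift a makes T map the family S to itself, and T' is its inverse. *)
pose T (c' : R -> M) t := g (c' (t + a)).
pose T' (c' : R -> M) t := h (c' (t - a)).
have Sc : S c by split => // s t; rewrite lc mdistxx expr0n addr0 real_normK ?num_real.
have SS c1 c2 : S c1 -> S c2 -> synchronous c1 c2.
  by move=> [l1 s1] [l2 s2];
    exact: (synchronous_trans catM l1 l2 (synchronous_sym s1) s2).
have ST c' : S c' -> S (T c').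
  move=> [l' s']; split; first exact: (lg g c' a gi l').
  apply: (synchronous_trans catM lc (lg g c' a gi l') sa).
  exact: (synchronous_isometry gi (synchronous_shift a s')).
have ST' c' : S c' -> S (T' c').
  move=> [l' s']; split; first exact: (lg h c' (- a) hi l').
  apply: (synchronous_trans catM lc (lg h c' (- a) hi l') (c := T' c)); last first.
    exact: (synchronous_isometry hi (synchronous_shift (- a) s')).
  have := synchronous_isometry hi (synchronous_shift (- a) sa).
  move=> /synchronous_sym; congr synchronous; apply/funext => t /=.
  by rewrite gh subrK.
(* [bd c' r]: seen from c', the family S has squared radius at most r. *)
pose bd (c' : R -> M) r := forall c'', S c'' -> d (c' 0) (c'' 0) ^+ 2 <= r.
have bdT c' r : S c' -> bd c' r -> bd (T c') r.
  move=> S' b c'' S''; have := b _ (ST' _ S'').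
  rewrite -(synchronous_dist a (SS _ _ S' (ST' _ S''))).
  by rewrite -gi.2 /T' subrr hg /T add0r.
pose E : set R := [set r | exists2 c', S c' & bd c' r].
have E0 : lbound E 0.
  by move=> r [c' S' b]; have := b c' S'; rewrite mdistxx expr0n.
have Ei : has_inf E.
  split; last by exists 0.
  exists (K ^+ 2); exists c => // c' S'.
  rewrite lerXn2r ?nnegrE ?dist_ge0 //; last first.
    by apply: HK => //; [case: S'|case: Sc|case: S'].
  by apply: le_trans (dist_ge0 (c 0) (c 0)) _; apply: HK => //; case: Sc.
(* The line midway between c1 and c2 has squared radius at most r minus a quarter of their squared
   distance, and this cannot fall below [inf E]. *)
have key c1 c2 r t : S c1 -> S c2 -> bd c1 r -> bd c2 r ->
    d (c1 t) (c2 t) ^+ 2 <= 4 * (r - inf E).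
  move=> S1 S2 b1 b2; rewrite (synchronous_dist t (SS _ _ S1 S2)).
  have [lm sm] := comb_line_synchronous catM lc S1.1 S2.1 S1.2 S2.2 (@half01 R).
  suff : inf E <= r - 4^-1 * d (c1 0) (c2 0) ^+ 2 by lra.
  apply: ge_inf; first by exists 0.
  exists (fun t => comb catM 2^-1 (c1 t) (c2 t)) => // c'' S''.
  rewrite metric_sym; apply: le_trans (combP catM _ _ _ half01) _.
  have := b1 _ S''; have := b2 _ S''.
  rewrite (metric_sym (c'' 0)) (metric_sym (c'' 0) (c2 0)); lra.
have /choice[u Hu] : forall n : nat, exists c', S c' /\ bd c' (inf E + n.+1%:R^-1).
  move=> n; have [|r [c' S' b] rE] := @inf_adherent _ E n.+1%:R^-1 _ Ei.
    by rewrite invr_gt0.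
  by exists c'; split => // c'' S''; apply: le_trans (b _ S'') (ltW rE).
have small (e : R) : 0 < e -> exists N, forall n, (N <= n)%N -> 4 * n.+1%:R^-1 <= e ^+ 2.
  move=> e0; exists (Num.bound (4 / e ^+ 2)) => n Nn.
  have n0 : 0 < n.+1%:R :> R by [].
  rewrite ler_pdivrMr // mulrC -ler_pdivrMr ?exprn_gt0 //.
  apply: le_trans (ltW (archi_boundP _)) _; first by rewrite divr_ge0 // sqr_ge0.
  by rewrite ler_nat leqW.
have near2 c1 c2 n (e : R) t : 0 < e -> S c1 -> S c2 ->
    bd c1 (inf E + n.+1%:R^-1) -> bd c2 (inf E + n.+1%:R^-1) ->
    4 * n.+1%:R^-1 <= e ^+ 2 -> d (c1 t) (c2 t) <= e.
  move=> e0 S1 S2 b1 b2 en; apply: le_of_sqr; first exact: ltW.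
  by apply: le_trans en; have := key _ _ _ t S1 S2 b1 b2; rewrite (addrC (inf E)) addrK.
have mono c' m n : (m <= n)%N -> bd c' (inf E + n.+1%:R^-1) -> bd c' (inf E + m.+1%:R^-1).
  move=> mn b c'' S''; apply: le_trans (b _ S'') _.
  by rewrite lerD2l lef_pV2 ?posrE // ler_nat.
have /choice[z Hz] : forall t, exists x : M, (fun n => u n t) @ \oo --> x.
  move=> t; apply: cauchy_dist_cvg => e e0; have [N HN] := small e e0.
  exists N => m n Nm Nn; apply: (near2 _ _ N) => //.
  - by case: (Hu m).
  - by case: (Hu n).
  - by apply: mono Nm _; case: (Hu m).
  - by apply: mono Nn _; case: (Hu n).
  - exact: HN.
have lz : geodesic_line z.
  move=> s t; apply: dist_lim_eq (Hz s) (Hz t) _.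
  by apply: nearW => n; have [[ln _] _] := Hu n; exact: ln.
(* T preserves the radius bound, so [u n] and [T (u n)] are both nearly optimal and thus close by
   [key]; in the limit T fixes z. *)
have zT t : g (z (t + a)) = z t.
  apply: dist_eq0; apply/eqP; rewrite eq_le dist_ge0 andbT.
  apply/ler_addgt0Pr => e e0; rewrite add0r.
  apply: dist_lim_le (isometry_cvg gi (Hz (t + a))) (Hz t) _.
  have [N HN] := small e e0; exists N => // n /= Nn.
  have [Sn bn] := Hu n.
  by apply: (near2 (T (u n)) (u n) n) => //; [exact: ST | exact: bdT | exact: HN].
exists z, (- a); split => // t.
by rewrite -(zT (t - a)) subrK.
Qed.

End invariant_line.

Theorem theorem1p2 (R : realType) (M : completeMetricType R)
    (M_CAT0 : CAT0 M) (M_visible : semi_uniformly_visible M)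
    (gamma : M -> M) (gamma_isometry : is_isometry gamma)
    (gamma_parabolic : parabolic gamma) :
  translation_length gamma = 0.
Proof.
have [vis noflat] := M_visible; have [nell nhyp] := gamma_parabolic.
have lb0 : lbound (range (fun p => mdist (gamma p) p)) 0.
  by move=> _ [p _ <-]; exact: dist_ge0.
apply/eqP; rewrite eq_le; apply/andP; split; last first.
  by apply: lb_le_inf => //; exists (mdist (gamma point) point); exists point.
rewrite leNgt; apply/negP => l0.
have [|c [lc pc]] := translated_line M_CAT0 vis gamma_isometry l0.
  by move=> p; rewrite metric_sym; apply: ge_inf; [exists 0 | exists p].
have [K HK] := synchronous_bounded M_CAT0 lc noflat.
have [z [a [lz za]]] := invariant_line M_CAT0 gamma_isometry lc pc HK.
have [a0|/eqP a0] := eqVneq a 0.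
  by apply: nell; exists (z 0); rewrite za a0 addr0.
by apply: nhyp; exists z; split => //; exists a.
Qed.
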